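(* The group $\mathcal{O}_{\mathcal{R}}(\mathfrak{g}_\lambda,\mathbf{k}_\lambda)$ is identified with (is isomorphic to) the direct product of the multiplicative group $\mathbb{Z}_2=\{1,-1\}$ with the groups $V_i\rtimes\mathcal{O}(V_i,\mathbf{k}_i)$ of rigid motions of the Euclidean spaces $(V_i,\mathbf{k}_i)$, $i=1,\ldots,s$: $$\mathcal{O}_{\mathcal{R}}(\mathfrak{g}_\lambda,\mathbf{k}_\lambda)\cong\mathbb{Z}_2\times\prod_{i=1}^s\big(V_i\rtimes\mathcal{O}(V_i,\mathbf{k}_i)\big).$$
   Context: Let $n\ge 1$ and $\lambda=(\lambda_1,\ldots,\lambda_n)\in\mathbb{R}^n$ with $0<\lambda_1\le\cdots\le\lambda_n$. The oscillator group $G_\lambda$ is the simply connected Lie group with underlying manifold $\mathbb{R}\times\mathbb{R}\times\mathbb{C}^n$ and product $$(t,s,z_1,\ldots,z_n)\cdot(t',s',z'_1,\ldots,z'_n)=\Big(t+t',\,s+s'+\tfrac12\sum_{j=1}^n\mathrm{Im}(\bar z_j e^{it\lambda_j}z'_j),\,\ldots,z_j+e^{it\lambda_j}z'_j,\ldots\Big).$$ Its Lie algebra $\mathfrak{g}_\lambda$ has basis $e_{-1},e_0,e_1,\ldots,e_n,\check e_1,\ldots,\check e_n$ with brackets $[e_{-1},e_j]=\lambda_j\check e_j$, $[e_j,\check e_j]=e_0$, $[e_{-1},\check e_j]=-\lambda_j e_j$, the other brackets being zero or deduced by antisymmetry. For $x=\sum_{j=-1}^n x_je_j+\sum_{j=1}^n\check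 x_j\check e_j$, the nondegenerate ad-invariant form $\mathbf{k}_\lambda$ is given by $\mathbf{k}_\lambda(x,x)=2x_{-1}x_0+\sum_{j=1}^n\frac1{\lambda_j}(x_j^2+\check x_j^2)$; it defines a bi-invariant Lorentzian metric on $G_\lambda$. $\mathcal{O}_{\mathcal{R}}(\mathfrak{g}_\lambda,\mathbf{k}_\lambda)$ is the group of $u\in\mathcal{O}(\mathfrak{g}_\lambda,\mathbf{k}_\lambda)$ preserving the curvature tensor $\mathcal{R}$ of $\mathbf{k}_\lambda$ at the identity, i.e. $u(\mathcal{R}(x,y)z)=\mathcal{R}(u(x),u(y))u(z)$ for all $x,y,z\in\mathfrak{g}_\lambda$; here $\mathcal{R}(x,y)=\frac14\mathrm{ad}_{[x,y]}$. Let $s$ be the number of distinct values among $\lambda_1,\ldots,\lambda_n$. For $i=1,\ldots,s$, $V_i$ is the span of the $e_r,\check e_r$ for which $\lambda_r$ equals the $i$-th distinct value (in increasing order), and $\mathbf{k}_i$ is the Euclidean form on $V_i$ induced by $\mathbf{k}_\lambda$ (via $V_i\equiv(\mathbb{R}e_0\oplus V_i)/\mathbb{R}e_0$). *)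

(* Defs.v *)
From HB Require Import structures.
From mathcomp Require Import all_boot all_order all_algebra.
From mathcomp Require Import boolp reals.
From mathcomp Require Import ring.

Set Implicit Arguments.
Unset Strict Implicit.
Unset Printing Implicit Defensive.

Import Order.TTheory GRing.Theory Num.Theory.
Local Open Scope ring_scope.

Section LinearGroups.
Variables (F : fieldType) (V : vectType F).

Record GL := MkGL { glval :> 'End(V); glvalP : lker glval == 0%VS }.

HB.instance Definition _ := [isSub for glval].
HB.instance Definition _ := [Choice of GL by <:].

Implicit Types u v w : GL.

Lemma gl1_subproof : lker (\1%VF : 'End(V)) == 0%VS.
Proof. by apply/lker0P => x y; rewrite !id_lfunE. Qed.

Lemma glM_subproof u v : lker (u \o v)%VF == 0%VS.
Proof.
apply/lker0P => x y; rewrite !comp_lfunE => h.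
exact: (lker0P (glvalP v)) (lker0P (glvalP u) _ _ h).
Qed.

Lemma glV_subproof u : lker (u^-1)%VF == 0%VS.
Proof.
apply/lker0P => x y h.
by rewrite -[x](lker0_lfunVK (glvalP u)) h lker0_lfunVK ?glvalP.
Qed.

Definition gl1 := MkGL gl1_subproof.
Definition glM u v := MkGL (glM_subproof u v).
Definition glV u := MkGL (glV_subproof u).

Lemma glMA : associative glM.
Proof. by move=> u v w; apply/val_inj; rewrite /= comp_lfunA. Qed.
Lemma gl1M : left_id gl1 glM.
Proof. by move=> u; apply/val_inj; rewrite /= comp_lfun1l. Qed.
Lemma glM1 : right_id gl1 glM.
Proof. by move=> u; apply/val_inj; rewrite /= comp_lfun1r. Qed.
Lemma glVM : left_inverse gl1 glV glM.
Proof. by move=> u; apply/val_inj; rewrite /= lker0_compVf ?glvalP. Qed.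
Lemma glMV : right_inverse gl1 glV glM.
Proof. by move=> u; apply/val_inj; rewrite /= lker0_compfV ?glvalP. Qed.

HB.instance Definition _ := isGroup.Build GL glMA gl1M glM1 glVM glMV.

Lemma glME u v x : (u * v)%g x = u (v x).
Proof. exact: comp_lfunE. Qed.

Lemma gl1E x : (1%g : GL) x = x.
Proof. exact: id_lfunE. Qed.

Lemma glVK u x : u ((u^-1)%g x) = x.
Proof. exact: lker0_lfunVK (glvalP u) _. Qed.

Variable b : V -> V -> F.

Definition isometry : {pred GL} :=
  fun u => `[< forall x y, b (u x) (u y) = b x y >].

Lemma isometry_group_closed : group_closed isometry.
Proof.
split=> [|u v /asboolP hu /asboolP hv]; apply/asboolP => x y.
  by rewrite !gl1E.
by rewrite !glME hu -hv !glVK.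
Qed.

Record orth := MkOrth { orthval :> GL; orthvalP : orthval \in isometry }.

HB.instance Definition _ := [isSub for orthval].
HB.instance Definition _ := [Choice of orth by <:].
HB.instance Definition _ :=
  SubChoice_isSubGroup.Build GL isometry orth isometry_group_closed.

(* The pair (a, u) stands for the motion x |-> u x + a. *)
Record motion := MkMotion { translation : V; rotation : orth }.

Definition pair_of_motion (m : motion) := (translation m, rotation m).
Definition motion_of_pair (p : V * orth) := MkMotion p.1 p.2.
Lemma pair_of_motionK : cancel pair_of_motion motion_of_pair.
Proof. by case. Qed.

HB.instance Definition _ := Choice.copy motion (can_type pair_of_motionK).

Definition motion1 := MkMotion 0 1%g.
Definition motionM (m p : motion) :=
  MkMotion (translation m + rotation m (translation p))
           (rotation m * rotation p)%g.
Definition motionV (m : motion) :=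
  MkMotion (- (rotation m)^-1%g (translation m)) (rotation m)^-1%g.

Lemma orthME (u v : orth) x : (u * v)%g x = u (v x).
Proof. exact: glME. Qed.
Lemma orth1E x : (1%g : orth) x = x.
Proof. exact: gl1E. Qed.

Lemma motionMA : associative motionM.
Proof.
move=> [a u] [c v] [d w]; congr MkMotion; rewrite /= ?mulgA //.
by rewrite linearD addrA orthME.
Qed.
Lemma motion1M : left_id motion1 motionM.
Proof. by move=> [a u]; congr MkMotion; rewrite /= ?mul1g // add0r orth1E. Qed.
Lemma motionM1 : right_id motion1 motionM.
Proof. by move=> [a u]; congr MkMotion; rewrite /= ?mulg1 // linear0 addr0. Qed.
Lemma motionVM : left_inverse motion1 motionV motionM.
Proof. by move=> [a u]; congr MkMotion; rewrite /= ?mulVg // addNr. Qed.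
Lemma motionMV : right_inverse motion1 motionV motionM.
Proof.
move=> [a u]; congr MkMotion; rewrite /= ?mulgV //.
by rewrite linearN /= lker0_lfunVK ?glvalP // subrr.
Qed.

HB.instance Definition _ :=
  isGroup.Build motion motionMA motion1M motionM1 motionVM motionMV.

Definition motion_act (m : motion) (x : V) := rotation m x + translation m.

Lemma motion_actM m p x : motion_act (m * p)%g x = motion_act m (motion_act p x).
Proof.
by rewrite /motion_act /= orthME linearD -addrA [in RHS](addrC _ (translation m)).
Qed.

End LinearGroups.

Section DependentProductGroup.
Variables (I : finType) (G : I -> groupType).
Implicit Types f g h : {dffun forall i : I, G i}.

Definition dffun_one : {dffun forall i : I, G i} := [ffun i => 1%g].
Definition dffun_mul f g : {dffun forall i : I, G i} := [ffun i => (f i * g i)%g].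
Definition dffun_inv f : {dffun forall i : I, G i} := [ffun i => (f i)^-1%g].

Lemma dffun_mulA : associative dffun_mul.
Proof. by move=> f g h; apply/ffunP => i; rewrite !ffunE mulgA. Qed.
Lemma dffun_mul1 : left_id dffun_one dffun_mul.
Proof. by move=> f; apply/ffunP => i; rewrite !ffunE mul1g. Qed.
Lemma dffun_1mul : right_id dffun_one dffun_mul.
Proof. by move=> f; apply/ffunP => i; rewrite !ffunE mulg1. Qed.
Lemma dffun_mulV : left_inverse dffun_one dffun_inv dffun_mul.
Proof. by move=> f; apply/ffunP => i; rewrite !ffunE mulVg. Qed.
Lemma dffun_Vmul : right_inverse dffun_one dffun_inv dffun_mul.
Proof. by move=> f; apply/ffunP => i; rewrite !ffunE mulgV. Qed.

HB.instance Definition _ := isGroup.Build {dffun forall i : I, G i}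
  dffun_mulA dffun_mul1 dffun_1mul dffun_mulV dffun_Vmul.

End DependentProductGroup.

(* {1, -1} under the multiplication of int. *)
Record Z2 := MkZ2 { z2val :> int; z2valP : z2val \in [:: 1; -1 : int] }.

HB.instance Definition _ := [isSub for z2val].
HB.instance Definition _ := [Choice of Z2 by <:].

Lemma z2M_subproof (a b : Z2) : (a : int) * b \in [:: 1; -1 : int].
Proof.
by case: a b => a ha [b hb] /=; move: ha hb; rewrite !inE
  => /orP[]/eqP-> /orP[]/eqP->.
Qed.

Definition z2_one := @MkZ2 1 isT.
Definition z2M (a b : Z2) := MkZ2 (z2M_subproof a b).

Lemma z2MA : associative z2M.
Proof. by move=> a b c; apply/val_inj; rewrite /= mulrA. Qed.
Lemma z21M : left_id z2_one z2M.
Proof. by move=> a; apply/val_inj; rewrite /= mul1r. Qed.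
Lemma z2M1 : right_id z2_one z2M.
Proof. by move=> a; apply/val_inj; rewrite /= mulr1. Qed.
Lemma z2VM : left_inverse z2_one id z2M.
Proof.
by move=> [a ha]; apply/val_inj => /=; move: ha; rewrite !inE => /orP[]/eqP->.
Qed.

HB.instance Definition _ := isGroup.Build Z2 z2MA z21M z2M1 z2VM z2VM.

(* Coordinates with respect to the basis
   e_{-1}, e_0, (e_j)_j, (\check e_j)_j, in this order. *)
Definition osc (R : realType) (n : nat) : Type :=
  (R^o * R^o * 'rV[R]_n * 'rV[R]_n)%type.

HB.instance Definition _ (R : realType) (n : nat) := Vector.on (osc R n).

Section Oscillator.
Variables (R : realType) (n : nat).
Local Notation g := (osc R n).
Implicit Types (x y z : g) (j : 'I_n).

Definition cm1 x : R := x.1.1.1.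
Definition c0 x : R := x.1.1.2.
Definition c x j : R := x.1.2 0 j.
Definition cc x j : R := x.2 0 j.

Definition em1 : g := (1, 0, 0, 0).
Definition e0 : g := (0, 1, 0, 0).
Definition e j : g := (0, 0, delta_mx 0 j, 0).
Definition ce j : g := (0, 0, 0, delta_mx 0 j).

Variable lam : 'I_n -> R.

Definition bracket x y : g :=
  (0,
   \sum_j (c x j * cc y j - cc x j * c y j),
   \row_j (- lam j * (cm1 x * cc y j - cc x j * cm1 y)),
   \row_j (lam j * (cm1 x * c y j - c x j * cm1 y))).

Definition klam x y : R :=
  cm1 x * c0 y + c0 x * cm1 y
  + \sum_j (lam j)^-1 * (c x j * c y j + cc x j * cc y j).

(* Curvature at the identity of the bi-invariant metric defined by klam:
   R(x, y) = 1/4 ad_[x, y]. *)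
Definition curv x y z : g := 4^-1 *: bracket (bracket x y) z.

Lemma bracket_em1_e j : bracket em1 (e j) = lam j *: ce j.
Proof.
rewrite /bracket /cm1 /c /cc /=; congr (_, _, _, _).
- by rewrite scaler0.
- by rewrite scaler0 big1 // => i _; rewrite !mxE; ring.
- by rewrite scaler0; apply/rowP => i; rewrite !mxE; ring.
- by apply/rowP => i; rewrite !mxE /=; case: eqVneq => [->|_] /=; ring.
Qed.

Lemma bracket_em1_ce j : bracket em1 (ce j) = - lam j *: e j.
Proof.
rewrite /bracket /cm1 /c /cc /=; congr (_, _, _, _).
- by rewrite scaler0.
- by rewrite scaler0 big1 // => i _; rewrite !mxE; ring.
- by apply/rowP => i; rewrite !mxE /=; case: eqVneq => [->|_] /=; ring.
- by rewrite scaler0; apply/rowP => i; rewrite !mxE; ring.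
Qed.

Lemma bracket_e_ce i j : bracket (e i) (ce j) = (i == j)%:R *: e0.
Proof.
rewrite /bracket /cm1 /c /cc /=; congr (_, _, _, _).
- by rewrite scaler0.
- rewrite (bigD1 i) //= big1 => [|l /negPf li]; rewrite !mxE /=.
    by rewrite eqxx addr0 mul0r subr0 mul1r /GRing.scale /= mulr1.
  by rewrite li mul0r mul0r subr0.
- by rewrite scaler0; apply/rowP => l; rewrite !mxE; ring.
- by rewrite scaler0; apply/rowP => l; rewrite !mxE; ring.
Qed.

Lemma bracket_e_e i j : bracket (e i) (e j) = 0.
Proof.
rewrite /bracket /cm1 /c /cc /=; congr (_, _, _, _).
- by rewrite big1 // => l _; rewrite !mxE; ring.
- by apply/rowP => l; rewrite !mxE; ring.
- by apply/rowP => l; rewrite !mxE; ring.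
Qed.

Lemma bracket_ce_ce i j : bracket (ce i) (ce j) = 0.
Proof.
rewrite /bracket /cm1 /c /cc /=; congr (_, _, _, _).
- by rewrite big1 // => l _; rewrite !mxE; ring.
- by apply/rowP => l; rewrite !mxE; ring.
- by apply/rowP => l; rewrite !mxE; ring.
Qed.

Lemma bracket_e0 x : bracket e0 x = 0.
Proof.
rewrite /bracket /cm1 /c /cc /=; congr (_, _, _, _).
- by rewrite big1 // => l _; rewrite !mxE; ring.
- by apply/rowP => l; rewrite !mxE; ring.
- by apply/rowP => l; rewrite !mxE; ring.
Qed.

Lemma bracketC x y : bracket x y = - bracket y x.
Proof.
rewrite /bracket; congr (_, _, _, _) => /=.
- by rewrite oppr0.
- by rewrite -sumrN; apply: eq_bigr => i _; ring.
- by apply/rowP => i; rewrite !mxE; ring.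
- by apply/rowP => i; rewrite !mxE; ring.
Qed.

Lemma klam_quad x :
  klam x x = 2 * cm1 x * c0 x + \sum_j (lam j)^-1 * (c x j ^+ 2 + cc x j ^+ 2).
Proof. by rewrite /klam; congr (_ + _); ring. Qed.

Lemma bracket_jacobi x y z :
  bracket x (bracket y z) + bracket y (bracket z x) + bracket z (bracket x y) = 0.
Proof.
rewrite /bracket /cm1 /c /cc /=; congr (_, _, _, _) => /=.
- by rewrite !addr0.
- by rewrite -!big_split /= big1 // => l _; rewrite !mxE; ring.
- by apply/rowP => l; rewrite !mxE; ring.
- by apply/rowP => l; rewrite !mxE; ring.
Qed.

Lemma klam_ad_invariant x y z : (forall j, lam j != 0) ->
  klam (bracket x y) z + klam y (bracket x z) = 0.
Proof.
move=> lam0; rewrite /klam /bracket /cm1 /c0 /c /cc /=.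
rewrite !mul0r !mulr0 add0r addr0 mulr_suml mulr_sumr -!big_split /=.
by rewrite big1 // => l _; rewrite !mxE; field.
Qed.

Lemma klam_nondegenerate x : (forall j, lam j != 0) ->
  (forall y, klam x y = 0) -> x = 0.
Proof.
move=> lam0 h.
have xm1 : cm1 x = 0.
  have := h e0; rewrite /klam /e0 /c0 /cm1 /c /cc /= big1 => [|l _].
    by rewrite mulr1 mulr0 !addr0.
  by rewrite !mxE; ring.
have x0 : c0 x = 0.
  have := h em1; rewrite /klam /em1 /c0 /cm1 /c /cc /= big1 => [|l _].
    by rewrite mulr1 mulr0 add0r addr0.
  by rewrite !mxE; ring.
have xe j : c x j = 0.
  have := h (e j); rewrite /klam /cm1 /c0 /c /cc /= !mulr0 !add0r.
  rewrite (bigD1 j) //= big1 => [|l /negPf lj]; rewrite !mxE /= ?eqxx ?lj /=.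
    by rewrite mulr0 !addr0 mulr1 => /eqP;
      rewrite mulf_eq0 invr_eq0 (negPf (lam0 j)) => /eqP.
  by ring.
have xce j : cc x j = 0.
  have := h (ce j); rewrite /klam /cm1 /c0 /c /cc /= !mulr0 !add0r.
  rewrite (bigD1 j) //= big1 => [|l /negPf lj]; rewrite !mxE /= ?eqxx ?lj /=.
    by rewrite mulr0 !addr0 add0r mulr1 => /eqP;
      rewrite mulf_eq0 invr_eq0 (negPf (lam0 j)) => /eqP.
  by rewrite mulr0 mulr0 addr0 mulr0.
case: x xm1 x0 xe xce {h} => [[[a b] v] w]; rewrite /cm1 /c0 /c /cc /=.
by move=> -> -> hv hw; congr (_, _, _, _); apply/rowP => j; rewrite mxE.
Qed.

Definition preserves_curv : {pred orth klam} :=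
  fun u => `[< forall x y z, u (curv x y z) = curv (u x) (u y) (u z) >].

Lemma preserves_curv_group_closed : group_closed preserves_curv.
Proof.
split=> [|u v /asboolP hu /asboolP hv]; apply/asboolP => x y z.
  by rewrite !orth1E.
have vK w : v (v^-1%g w) = w by rewrite -orthME mulgV orth1E.
rewrite !orthME -hu; congr (orthval u _).
by rewrite -{1}[x]vK -{1}[y]vK -{1}[z]vK -hv -orthME mulVg orth1E.
Qed.

Record orthR := MkOrthR { orthRval :> orth klam;
                          orthRvalP : orthRval \in preserves_curv }.

HB.instance Definition _ := [isSub for orthRval].
HB.instance Definition _ := [Choice of orthR by <:].
HB.instance Definition _ := SubChoice_isSubGroup.Build
  (orth klam) preserves_curv orthR preserves_curv_group_closed.

(* The distinct values of lam in increasing order. *)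
Definition lam_values : seq R := sort <=%O (undup (codom lam)).

Definition Vspace (i : 'I_(size lam_values)) : {vspace g} :=
  let J := [seq r <- enum 'I_n | lam r == lam_values`_i] in
  <<[seq e r | r <- J] ++ [seq ce r | r <- J]>>%VS.

(* e_0 is orthogonal to Vspace i and isotropic, so the form induced on
   (R e_0 + Vspace i) / R e_0 is the restriction of klam to Vspace i. *)
Definition kV (i : 'I_(size lam_values)) (x y : subvs_of (Vspace i)) : R :=
  klam (vsval x) (vsval y).

End Oscillator.

(* Main.v *)
(* The curvature is R(x, y) z = 1/4 (z_{-1} L b - k(L b, z) e_0), where
   b = x_{-1} y - y_{-1} x and L = - ad(e_{-1})^2 multiplies e_j and \check e_j
   by lam_j^2.  Its range spans e_0 and all e_j, \check e_j, so an isometry u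
   preserving it preserves this hyperplane and its orthogonal, the line of e_0.
   Applied to R(e_{-1}, x) e_{-1} = 1/4 L x, invariance says that modulo e_0 the
   map u intertwines L with s^2 L, where s is the e_{-1}-coordinate of u e_{-1}.
   Comparing largest eigenvalues for u and its inverse gives s = 1 or s = -1, so
   u maps each V_i to V_i + R e_0.  Modulo e_0, s u is x |-> u_i x on V_i and
   e_{-1} |-> e_{-1} + sum_i a_i; this datum is multiplicative in u, and the
   e_0-coordinates are recovered from it because u is an isometry. *)

Require Import Defs.
From HB Require Import structures.
From mathcomp Require Import all_boot all_order all_algebra.
From mathcomp Require Import boolp reals.
From mathcomp Require Import ring.

Set Implicit Arguments.
Unset Strict Implicit.
Unset Printing Implicit Defensive.

Import Order.TTheory GRing.Theory Num.Theory.
Local Open Scope ring_scope.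

(** * Isometries of a bilinear form *)

Section Isometries.
Variables (F : fieldType) (V : vectType F) (b : V -> V -> F).

Lemma orth_ext (u v : orth b) : (forall x, u x = v x) -> u = v.
Proof. by move=> uv; do 2!apply/val_inj; apply/lfunP. Qed.

Lemma orthE (u : orth b) x y : b (u x) (u y) = b x y.
Proof. by have /asboolP := orthvalP u. Qed.

Lemma motion_ext (m p : motion b) :
    translation m = translation p -> rotation m =1 rotation p -> m = p.
Proof. by case: m p => [a u] [d v] /= -> /orth_ext ->. Qed.

(** If [f x = f y] then [x - y] is orthogonal to everything, so non-degeneracy forces a trivial
    kernel, which is what [GL] demands. It serves both for [klam] on the Lie algebra and for [kV] on
    each eigenspace. *)
Lemma isometry_orth (f : V -> V) : linear f ->
    (forall x, (forall y, b x y = 0) -> x = 0) ->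
    (forall x y z, b (x - y) z = b x z - b y z) ->
    (forall x y, b (f x) (f y) = b x y) ->
  exists u : orth b, u =1 f.
Proof.
move=> f_lin b_nondeg b_sub f_iso.
pose h : {linear V -> V} := HB.pack f
  (GRing.isSemilinear.Build F V V _ f (GRing.semilinear_linear f_lin)).
have hE : linfun h =1 f by move=> x; rewrite lfunE.
have h_inj : lker (linfun h) == 0%VS.
  apply/lker0P => x y; rewrite !hE => fxy.
  apply/eqP; rewrite -subr_eq0; apply/eqP/b_nondeg => z.
  by rewrite b_sub -(f_iso x) -(f_iso y) fxy subrr.
have h_orth : MkGL h_inj \in Defs.isometry b.
  by apply/asboolP => x y /=; rewrite !hE f_iso.
by exists (MkOrth h_orth) => x; rewrite /= hE.
Qed.

End Isometries.

(** * The metric and the curvature in coordinates *)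

Section Coordinates.
Variables (R : realType) (n : nat).
Local Notation g := (osc R n).
Implicit Types (x y z : g) (a b : R) (j r : 'I_n) (w : 'I_n -> R).

Lemma osc_ext x y : cm1 x = cm1 y -> c0 x = c0 y ->
  (forall j, c x j = c y j) -> (forall j, cc x j = cc y j) -> x = y.
Proof.
case: x y => [[[a1 a2] v1] v2] [[[b1 b2] w1] w2].
rewrite /cm1 /c0 /c /cc /= => -> -> h1 h2.
by congr (_, _, _, _); apply/rowP.
Qed.

(** One diagonal operator underlies [horiz], [lap] and [block]: composition multiplies the weights,
    so these commute, and each is self-adjoint for [klam]. *)
Definition hscale w x : g :=
  (0, 0, \row_r (w r * c x r), \row_r (w r * cc x r)).

Lemma cm1D x y : cm1 (x + y) = cm1 x + cm1 y. Proof. by []. Qed.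
Lemma c0D x y : c0 (x + y) = c0 x + c0 y. Proof. by []. Qed.
Lemma cD x y j : c (x + y) j = c x j + c y j. Proof. exact: mxE. Qed.
Lemma ccD x y j : cc (x + y) j = cc x j + cc y j. Proof. exact: mxE. Qed.
Lemma cm1Z a x : cm1 (a *: x) = a * cm1 x. Proof. by []. Qed.
Lemma c0Z a x : c0 (a *: x) = a * c0 x. Proof. by []. Qed.
Lemma cZ a x j : c (a *: x) j = a * c x j. Proof. exact: mxE. Qed.
Lemma ccZ a x j : cc (a *: x) j = a * cc x j. Proof. exact: mxE. Qed.
Lemma cm1N x : cm1 (- x) = - cm1 x. Proof. by []. Qed.
Lemma c0N x : c0 (- x) = - c0 x. Proof. by []. Qed.
Lemma cN x j : c (- x) j = - c x j. Proof. exact: mxE. Qed.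
Lemma ccN x j : cc (- x) j = - cc x j. Proof. exact: mxE. Qed.
Lemma cm1_0 : cm1 (0 : g) = 0. Proof. by []. Qed.
Lemma c0_0 : c0 (0 : g) = 0. Proof. by []. Qed.
Lemma c_0 j : c (0 : g) j = 0. Proof. exact: mxE. Qed.
Lemma cc_0 j : cc (0 : g) j = 0. Proof. exact: mxE. Qed.
Lemma cm1_hscale w x : cm1 (hscale w x) = 0. Proof. by []. Qed.
Lemma c0_hscale w x : c0 (hscale w x) = 0. Proof. by []. Qed.
Lemma c_hscale w x j : c (hscale w x) j = w j * c x j. Proof. exact: mxE. Qed.
Lemma cc_hscale w x j : cc (hscale w x) j = w j * cc x j. Proof. exact: mxE. Qed.
Lemma cm1_em1 : cm1 (em1 R n) = 1. Proof. by []. Qed.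
Lemma c0_em1 : c0 (em1 R n) = 0. Proof. by []. Qed.
Lemma cm1_e0 : cm1 (e0 R n) = 0. Proof. by []. Qed.
Lemma c0_e0 : c0 (e0 R n) = 1. Proof. by []. Qed.
Lemma cm1_e j : cm1 (e R j) = 0. Proof. by []. Qed.
Lemma c0_e j : c0 (e R j) = 0. Proof. by []. Qed.
Lemma cm1_ce j : cm1 (ce R j) = 0. Proof. by []. Qed.
Lemma c0_ce j : c0 (ce R j) = 0. Proof. by []. Qed.
Lemma c_em1 j : c (em1 R n) j = 0. Proof. exact: mxE. Qed.
Lemma cc_em1 j : cc (em1 R n) j = 0. Proof. exact: mxE. Qed.
Lemma c_e0 j : c (e0 R n) j = 0. Proof. exact: mxE. Qed.
Lemma cc_e0 j : cc (e0 R n) j = 0. Proof. exact: mxE. Qed.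
Lemma c_e i j : c (e R i) j = (i == j)%:R.
Proof. by rewrite /c !mxE /= eq_sym. Qed.
Lemma cc_e i j : cc (e R i) j = 0. Proof. exact: mxE. Qed.
Lemma c_ce i j : c (ce R i) j = 0. Proof. exact: mxE. Qed.
Lemma cc_ce i j : cc (ce R i) j = (i == j)%:R.
Proof. by rewrite /cc !mxE /= eq_sym. Qed.

Definition coordD := (cm1D, c0D, cD, ccD).
Definition coordZ := (cm1Z, c0Z, cZ, ccZ).
Definition coordN := (cm1N, c0N, cN, ccN).
Definition coord0 := (cm1_0, c0_0, c_0, cc_0).
Definition coord_hscale := (cm1_hscale, c0_hscale, c_hscale, cc_hscale).
Definition coord_basis :=
  (cm1_em1, c0_em1, c_em1, cc_em1, cm1_e0, c0_e0, c_e0, cc_e0,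
   cm1_e, c0_e, c_e, cc_e, cm1_ce, c0_ce, c_ce, cc_ce).
Definition coordE :=
  (coordD, coordZ, coordN, coord0, coord_hscale, coord_basis).

Lemma cm1_sum (I : Type) (s : seq I) (P : pred I) (f : I -> g) :
  cm1 (\sum_(i <- s | P i) f i) = \sum_(i <- s | P i) cm1 (f i).
Proof. exact: (big_morph _ cm1D cm1_0). Qed.

Lemma c0_sum (I : Type) (s : seq I) (P : pred I) (f : I -> g) :
  c0 (\sum_(i <- s | P i) f i) = \sum_(i <- s | P i) c0 (f i).
Proof. exact: (big_morph _ c0D c0_0). Qed.

Lemma c_sum (I : Type) (s : seq I) (P : pred I) (f : I -> g) j :
  c (\sum_(i <- s | P i) f i) j = \sum_(i <- s | P i) c (f i) j.
Proof. exact: (big_morph (fun x => c x j) (fun x y => cD x y j) (c_0 j)). Qed.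

Lemma cc_sum (I : Type) (s : seq I) (P : pred I) (f : I -> g) j :
  cc (\sum_(i <- s | P i) f i) j = \sum_(i <- s | P i) cc (f i) j.
Proof. exact: (big_morph (fun x => cc x j) (fun x y => ccD x y j) (cc_0 j)). Qed.

Lemma hscale_is_linear w : linear (hscale w).
Proof.
by move=> a x y; apply: osc_ext => *; rewrite !coordE; ring.
Qed.

HB.instance Definition _ w :=
  GRing.isSemilinear.Build R g g _ (hscale w)
    (GRing.semilinear_linear (hscale_is_linear w)).

Lemma hscale_comp w w' x : hscale w (hscale w' x) = hscale (fun r => w r * w' r) x.
Proof. by apply: osc_ext => *; rewrite !coordE //; ring. Qed.

Lemma eq_hscale w w' : w =1 w' -> hscale w =1 hscale w'.
Proof. by move=> ww' x; apply: osc_ext => *; rewrite !coordE ?ww'. Qed.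

Definition horiz := hscale (fun=> 1).

HB.instance Definition _ := GRing.Linear.copy horiz (hscale (fun=> 1)).

Lemma osc_decomp x : x = cm1 x *: em1 R n + c0 x *: e0 R n + horiz x.
Proof.
apply: osc_ext => *; rewrite !coordE; ring.
Qed.

Lemma hscale_em1 w : hscale w (em1 R n) = 0.
Proof. by apply: osc_ext => *; rewrite !coordE; ring. Qed.

Lemma hscale_e0 w : hscale w (e0 R n) = 0.
Proof. by apply: osc_ext => *; rewrite !coordE; ring. Qed.

Lemma hscale_horiz w x : hscale w (horiz x) = hscale w x.
Proof. by rewrite /horiz hscale_comp; apply: eq_hscale => r; rewrite mulr1. Qed.

Lemma horiz_hscale w x : horiz (hscale w x) = hscale w x.
Proof. by rewrite /horiz hscale_comp; apply: eq_hscale => r; rewrite mul1r. Qed.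

Variable lam : 'I_n -> R.
Local Notation k := (klam lam).

Lemma klamC x y : k x y = k y x.
Proof.
rewrite /klam; congr (_ + _); first by ring.
by apply: eq_bigr => j _; ring.
Qed.

Lemma klamDl x y z : k (x + y) z = k x z + k y z.
Proof.
rewrite /klam addrACA -big_split /=; congr (_ + _).
  by rewrite !coordE; ring.
by apply: eq_bigr => j _; rewrite !coordE; ring.
Qed.

Lemma klamZl a x z : k (a *: x) z = a * k x z.
Proof.
rewrite /klam mulrDr mulr_sumr; congr (_ + _).
  by rewrite !coordE; ring.
by apply: eq_bigr => j _; rewrite !coordE; ring.
Qed.

Lemma klamDr x y z : k z (x + y) = k z x + k z y.
Proof. by rewrite klamC klamDl !(klamC z). Qed.

Lemma klamZr a x z : k z (a *: x) = a * k z x.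
Proof. by rewrite klamC klamZl (klamC z). Qed.

Lemma klam0l z : k 0 z = 0.
Proof. by rewrite -(scale0r 0) klamZl mul0r. Qed.

Lemma klam0r z : k z 0 = 0.
Proof. by rewrite klamC klam0l. Qed.

Lemma klamBl x y z : k (x - y) z = k x z - k y z.
Proof. by rewrite -scaleN1r klamDl klamZl mulN1r. Qed.

Lemma klam_e0l x : k (e0 R n) x = cm1 x.
Proof.
rewrite /klam big1 => [|j _]; last by rewrite !coordE; ring.
by rewrite !coordE; ring.
Qed.

Lemma klam_em1l x : k (em1 R n) x = c0 x.
Proof.
rewrite /klam big1 => [|j _]; last by rewrite !coordE; ring.
by rewrite !coordE; ring.
Qed.

Lemma klam_e0r x : k x (e0 R n) = cm1 x.
Proof. by rewrite klamC klam_e0l. Qed.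

Lemma klam_em1r x : k x (em1 R n) = c0 x.
Proof. by rewrite klamC klam_em1l. Qed.

Lemma klam_hscale w x y : k (hscale w x) y = k x (hscale w y).
Proof.
rewrite /klam !coordE; congr (_ + _); first by ring.
by apply: eq_bigr => j _; rewrite !coordE; ring.
Qed.

(** The vector $e_0$ is isotropic and orthogonal to this hyperplane, so discarding the
    $e_0$-components does not change the form. *)
Lemma klam_horiz x y : cm1 x = 0 -> cm1 y = 0 ->
  k (horiz x) (horiz y) = k x y.
Proof.
move=> x0 y0; rewrite [in RHS](osc_decomp x) [in RHS](osc_decomp y) x0 y0.
rewrite !scale0r !add0r !(klamDl, klamDr, klamZl, klamZr) !klam_e0l klam_e0r.
by rewrite !coordE; ring.
Qed.

Lemma klam_suml (I : Type) (s : seq I) (P : pred I) (f : I -> g) z :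
  k (\sum_(i <- s | P i) f i) z = \sum_(i <- s | P i) k (f i) z.
Proof.
exact: (big_morph (fun x => k x z) (fun x y => klamDl x y z) (klam0l z)).
Qed.

Definition lap := hscale (fun r => lam r ^+ 2).

HB.instance Definition _ :=
  GRing.Linear.copy lap (hscale (fun r => lam r ^+ 2)).

Lemma c_bracket x y j :
  c (bracket lam x y) j = - lam j * (cm1 x * cc y j - cc x j * cm1 y).
Proof. exact: mxE. Qed.

Lemma cc_bracket x y j :
  cc (bracket lam x y) j = lam j * (cm1 x * c y j - c x j * cm1 y).
Proof. exact: mxE. Qed.

(** As $e_0$ is central, only $[x,y]$ modulo $e_0$ matters, and this is $\mathrm{ad}(e_{-1})$
    applied to $x_{-1}y-y_{-1}x$; the outer bracket supplies the second factor of $L$. *)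
Lemma curvE x y z : (forall j, lam j != 0) ->
  let v := lap (cm1 x *: y - cm1 y *: x) in
  curv lam x y z = 4^-1 *: (cm1 z *: v - k v z *: e0 R n).
Proof.
(* The weight $1/\lambda_j$ of the metric cancels one of the two factors $\lambda_j$ in $L$, leaving
   the single one produced by the inner bracket. *)
move=> lam0 v; have kv : k v z = - c0 (bracket lam (bracket lam x y) z).
  rewrite [k v z]/klam !coordE !mul0r add0r /c0 /= -sumrN add0r.
  by apply: eq_bigr => j _; rewrite !(coordE, c_bracket, cc_bracket); field.
apply: osc_ext => [||j|j]; rewrite /curv !(coordE, c_bracket, cc_bracket).
- by rewrite /cm1 /=; ring.
- by rewrite kv; ring.
- by rewrite /cm1 /=; ring.
- by rewrite /cm1 /=; ring.
Qed.

End Coordinates.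

(** * The eigenspaces V_i *)

Section Blocks.
Variables (R : realType) (n : nat) (lam : 'I_n -> R).
Local Notation g := (osc R n).
Local Notation k := (klam lam).
Local Notation mu i := ((lam_values lam)`_i).
Local Notation index := 'I_(size (lam_values lam)).
Implicit Types (x y z : g) (i : index).

(** The weights are indicators: this is the projection onto $V_i$ along $e_{-1}$, $e_0$ and the
    other eigenspaces. *)
Definition block i := @hscale R n (fun r => (lam r == mu i)%:R).

HB.instance Definition _ i :=
  GRing.Linear.copy (block i) (@hscale R n (fun r => (lam r == mu i)%:R)).

(** Since [lam_values] has no repetitions, each [lam r] occurs at a single index. The boolean form
    lets the indicator weights of [block] be rewritten directly. *)
Lemma lam_value_index r : exists i, forall i', (lam r == mu i') = (i' == i).
Proof.
have lam_r : lam r \in lam_values lam by rewrite mem_sort mem_undup codom_f.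
have ltr : (seq.index (lam r) (lam_values lam) < size (lam_values lam))%N.
  by rewrite index_mem.
exists (Ordinal ltr) => i'.
rewrite -{1}(nth_index 0 lam_r) nth_uniq // ?sort_uniq ?undup_uniq //.
by rewrite eq_sym.
Qed.

Lemma block_neq i j x : i != j -> block i (block j x) = 0.
Proof.
move=> ij; rewrite /block hscale_comp -[RHS](scale0r x).
apply: osc_ext => [||r|r]; rewrite !coordE ?mul0r //.
all: have [i' e] := lam_value_index r.
all: rewrite !e; have [<-|_] := eqVneq i i'; last by rewrite !mul0r.
all: by rewrite eq_sym (negPf ij) mulr0 mul0r.
Qed.

Lemma sum_block x : \sum_i block i x = horiz x.
Proof.
have sum1 r : \sum_(i < size (lam_values lam)) (lam r == mu i)%:R = 1 :> R.
  have [i e] := lam_value_index r.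
  rewrite (bigD1 i) //= e eqxx big1 ?addr0 // => j /negPf.
  by rewrite e => ->.
apply: osc_ext => [||r|r].
- by rewrite cm1_sum big1.
- by rewrite c0_sum big1.
- rewrite c_sum !coordE -(sum1 r) mulr_suml.
  by apply: eq_bigr => i _; rewrite !coordE.
- rewrite cc_sum !coordE -(sum1 r) mulr_suml.
  by apply: eq_bigr => i _; rewrite !coordE.
Qed.

Lemma lap_block i x : lap lam (block i x) = mu i ^+ 2 *: block i x.
Proof.
apply: osc_ext => [||r|r]; rewrite !coordE ?mulr0 //.
all: by case: eqVneq => [->|_]; rewrite ?mul0r ?mulr0.
Qed.

Lemma block_lap i x : block i (lap lam x) = mu i ^+ 2 *: block i x.
Proof.
rewrite -lap_block /lap /block !hscale_comp.
by apply: eq_hscale => r; rewrite mulrC.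
Qed.

Lemma horiz_block i x : horiz (block i x) = block i x.
Proof. exact: horiz_hscale. Qed.

Lemma block_horiz i x : block i (horiz x) = block i x.
Proof. exact: hscale_horiz. Qed.

Lemma block_mem i x : block i x \in Vspace i.
Proof.
have sum_delta (f : 'I_n -> R) j :
    \sum_(r | lam r == mu i) f r * (r == j)%:R = (lam j == mu i)%:R * f j.
  rewrite big_mkcond (bigD1 j) //= eqxx big1 => [|r /negPf rj].
    by case: eqP; rewrite addr0 ?mulr1 ?mul1r ?mul0r.
  by rewrite rj mulr0 if_same.
have -> : block i x =
    \sum_(r | lam r == mu i) (c x r *: e R r + cc x r *: ce R r).
  apply: osc_ext => [||j|j].
  - by rewrite cm1_sum big1 // => r _; rewrite !coordE; ring.
  - by rewrite c0_sum big1 // => r _; rewrite !coordE; ring.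
  - rewrite c_sum coordE -sum_delta; apply: eq_bigr => r _.
    by rewrite !coordE; ring.
  - rewrite cc_sum coordE -sum_delta; apply: eq_bigr => r _.
    by rewrite !coordE; ring.
apply: rpred_sum => r ri; apply: rpredD; apply: rpredZ; apply: memv_span.
  by rewrite mem_cat map_f // mem_filter ri mem_enum.
by rewrite mem_cat orbC map_f // mem_filter ri mem_enum.
Qed.

Lemma block_vsval i (w : subvs_of (Vspace i)) : block i (vsval w) = vsval w.
Proof.
move: (vsval w) (subvsP w) => {w} x.
rewrite /Vspace; set X := _ ++ _; rewrite -(in_tupleE X) => xX.
(* By linearity it is enough to see that [block i] fixes each vector of the spanning list. *)
rewrite {2}(coord_span xX) {1}(coord_span xX) linear_sum; apply: eq_bigr => l _ /=.
rewrite linearZ /=; congr (_ *: _).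
have : (in_tuple X)`_l \in X by rewrite mem_nth.
rewrite mem_cat => /orP[] /mapP [r]; rewrite mem_filter => /andP[/eqP ri _] ->.
all: apply: osc_ext => [||j|j]; rewrite !coordE ?mulr0 //.
all: by case: (eqVneq r j) => [<-|_]; rewrite ?mulr0 // ri eqxx mul1r.
Qed.

Definition to_block i x : subvs_of (Vspace i) := vsproj (Vspace i) (block i x).

Lemma to_blockK i x : vsval (to_block i x) = block i x.
Proof. by rewrite /to_block vsprojK ?block_mem. Qed.

Lemma vsval_to_block i (w : subvs_of (Vspace i)) : to_block i (vsval w) = w.
Proof. by rewrite /to_block block_vsval vsvalK. Qed.

Lemma horiz_vsval i (w : subvs_of (Vspace i)) : horiz (vsval w) = vsval w.
Proof. by rewrite -(block_vsval w) horiz_block. Qed.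

Lemma lap_vsval i (w : subvs_of (Vspace i)) :
  lap lam (vsval w) = mu i ^+ 2 *: vsval w.
Proof. by rewrite -(block_vsval w) lap_block. Qed.

Lemma block_sum_vsval (w : forall i, subvs_of (Vspace i)) i :
  block i (\sum_j vsval (w j)) = vsval (w i).
Proof.
rewrite linear_sum (bigD1 i) //= block_vsval big1 ?addr0 // => j ji.
by rewrite -(block_vsval (w j)) block_neq // eq_sym.
Qed.

(** The eigenspaces are mutually orthogonal: moving the self-adjoint [block i] to the right-hand sum
    isolates its [i]-th term. *)
Lemma klam_sum_vsval (v w : forall i, subvs_of (Vspace i)) :
  k (\sum_i vsval (v i)) (\sum_i vsval (w i))
  = \sum_i k (vsval (v i)) (vsval (w i)).
Proof.
rewrite klam_suml; apply: eq_bigr => i _.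
by rewrite -{1}(block_vsval (v i)) /block klam_hscale -/(block i) block_sum_vsval.
Qed.

(** Pairing [w] with an arbitrary vector is the same as pairing it with the projection of that
    vector to $V_i$, so non-degeneracy descends from [klam]. *)
Lemma kV_nondegenerate i (w : subvs_of (Vspace i)) :
  (forall r, lam r != 0) -> (forall w', kV w w' = 0) -> w = 0.
Proof.
move=> lam0 w0; apply/val_inj/(klam_nondegenerate lam0) => y /=.
rewrite -(block_vsval w) /block klam_hscale -/(block i) -to_blockK.
exact: w0.
Qed.

End Blocks.

(** * Isometries preserving the curvature *)

Section CurvatureIsometries.
Variables (R : realType) (n : nat) (lam : 'I_n -> R).
Hypothesis n_gt0 : (0 < n)%N.
Hypothesis lam_gt0 : forall i, 0 < lam i.
Hypothesis lam_le : forall i j : 'I_n, (i <= j)%N -> lam i <= lam j.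
Local Notation g := (osc R n).
Local Notation k := (klam lam).
Local Notation em1 := (em1 R n).
Local Notation e0 := (e0 R n).
Local Notation L := (lap lam).
Local Notation mu i := ((lam_values lam)`_i).
Local Notation index := 'I_(size (lam_values lam)).
Implicit Types (x y z : g) (i : index) (u v : orthR lam).

Let lam_neq0 j : lam j != 0. Proof. exact: lt0r_neq0. Qed.

(** * The invariant hyperplane and the sign of an isometry *)

Lemma orthR_curv u x y z : u (curv lam x y z) = curv lam (u x) (u y) (u z).
Proof. by have /asboolP := orthRvalP u. Qed.

Lemma orthRM u v x : (u * v)%g x = u (v x).
Proof. exact: glME. Qed.

Lemma orthRVK u x : u ((u^-1)%g x) = x.
Proof. exact: glVK. Qed.

Lemma curv_em1 x : curv lam em1 x em1 = 4^-1 *: L x.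
Proof.
have lap_x : L (x - cm1 x *: em1) = L x.
  by rewrite linearB linearZ /= [L em1]hscale_em1 scaler0 subr0.
by rewrite curvE // cm1_em1 !scale1r lap_x klam_em1r scale0r subr0.
Qed.

Lemma orthR_lap u x : u (L x) = 4 *: curv lam (u em1) (u x) (u em1).
Proof.
by rewrite -orthR_curv curv_em1 linearZ scalerA divff ?scale1r ?pnatr_eq0.
Qed.

Lemma cm1_curv x y z : cm1 (curv lam x y z) = 0.
Proof. by rewrite /curv cm1Z mulr0. Qed.

Lemma klam_e j x : k (e R j) x = (lam j)^-1 * c x j.
Proof.
rewrite /klam (bigD1 j) //= !coordE eqxx big1 => [|i /negPf ij].
  by rewrite /=; ring.
by rewrite !coordE eq_sym ij /=; ring.
Qed.

Lemma curv_e j : curv lam em1 (e R j) (e R j) = - (lam j / 4) *: e0.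
Proof.
rewrite curvE // !coordE scale1r !scale0r subr0 sub0r klam_hscale klam_e.
rewrite !coordE eqxx scalerN scalerA scaleNr; congr (- (_ *: _)).
by rewrite /=; field.
Qed.

Lemma cm1_orthR_e0 u : cm1 (u e0) = 0.
Proof.
(* Some index must exist for $e_0$ to be a multiple of a curvature value; values of the curvature
   have no $e_{-1}$-coordinate, and [u] permutes them. *)
pose j := Ordinal n_gt0.
have : cm1 (u (curv lam em1 (e R j) (e R j))) = 0 by rewrite orthR_curv cm1_curv.
rewrite curv_e linearZ coordE => /eqP; rewrite mulf_eq0 oppr_eq0 mulf_eq0.
by rewrite invr_eq0 pnatr_eq0 (negPf (lam_neq0 j)) => /eqP.
Qed.

Definition sgn u : R := cm1 (u em1).

Lemma cm1_orthR u x : cm1 (u x) = sgn u * cm1 x.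
Proof.
(* All $\lambda_r$ are nonzero, so a horizontal vector lies in the image of [L], and [orthR_lap]
   makes its image under [u] a multiple of a curvature value. *)
have hx : horiz x = L (hscale (fun r => (lam r ^+ 2)^-1) x).
  by rewrite /lap hscale_comp; apply: eq_hscale => r; rewrite divff ?expf_neq0.
rewrite [in LHS](osc_decomp x) hx !linearD !linearZ /= !coordE cm1_orthR_e0.
by rewrite orthR_lap coordE cm1_curv /sgn; ring.
Qed.

Lemma sgnMV u : sgn u * sgn u^-1%g = 1.
Proof. by rewrite -cm1_orthR orthRVK. Qed.

(** Through [klam], $e_0$ represents the functional [cm1], and the adjoint of [u] is its inverse. *)
Lemma orthR_e0 u : u e0 = sgn u^-1%g *: e0.
Proof.
apply/eqP; rewrite -subr_eq0; apply/eqP/(klam_nondegenerate lam_neq0) => y.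
rewrite klamBl klamZl klam_e0l -{1}[y](orthRVK u) orthE klam_e0l cm1_orthR.
by rewrite subrr.
Qed.

(** One factor [sgn u] comes from each of the two occurrences of [u em1] in the curvature; [horiz]
    removes the remaining multiple of $e_0$. *)
Lemma horiz_orthR_lap u x :
  cm1 x = 0 -> horiz (u (L x)) = sgn u ^+ 2 *: L (u x).
Proof.
move=> x0; rewrite orthR_lap curvE // scalerA divff ?pnatr_eq0 // scale1r.
rewrite (cm1_orthR u x) x0 mulr0 scale0r subr0 linearB !linearZ /= [horiz e0]hscale_e0.
by rewrite oppr0 scaler0 addr0 [horiz _]horiz_hscale scalerA.
Qed.

(* [u] maps the top eigenspace of [L] into the eigenspace for the top
   eigenvalue divided by [sgn u ^+ 2]. *)
Lemma sgn_sqr_ge1 u : 1 <= sgn u ^+ 2.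
Proof.
have n1 : (n.-1 < n)%N by rewrite prednK.
(* The values increase with the index, so the last one is the largest. *)
pose m := Ordinal n1; pose x := u (e R m).
have le_m r : lam r <= lam m by apply: lam_le; rewrite -ltnS prednK.
have lap_e : L (e R m) = lam m ^+ 2 *: e R m.
  apply: osc_ext => [||r|r]; rewrite !coordE ?mulr0 //.
  by case: eqVneq => [<-|_]; rewrite ?mulr0.
have := @horiz_orthR_lap u (e R m) erefl; rewrite lap_e !linearZ /= -/x => eig.
have eigc r : (lam m ^+ 2 - sgn u ^+ 2 * lam r ^+ 2) * c x r = 0.
  have /(congr1 (fun y => c y r)) := eig; rewrite !coordE => eigr.
  by rewrite mulrBl -[X in X - _]mul1r mulrCA eigr; ring.
have eigcc r : (lam m ^+ 2 - sgn u ^+ 2 * lam r ^+ 2) * cc x r = 0.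
  have /(congr1 (fun y => cc y r)) := eig; rewrite !coordE => eigr.
  by rewrite mulrBl -[X in X - _]mul1r mulrCA eigr; ring.
have [//|lt1] := leP 1 (sgn u ^+ 2).
(* If [sgn u ^+ 2 < 1], no eigenvalue of [L] can match, so every horizontal coordinate of [x]
   vanishes. Then [x] is isotropic, against the norm $1/\lambda_m$ of $e_m$. *)
have gt0 r : lam m ^+ 2 - sgn u ^+ 2 * lam r ^+ 2 != 0.
  apply: lt0r_neq0; rewrite subr_gt0.
  apply: (@le_lt_trans _ _ (sgn u ^+ 2 * lam m ^+ 2)).
    apply: ler_wpM2l; first exact: sqr_ge0.
    by apply: lerXn2r (le_m r); rewrite nnegrE ltW.
  by rewrite gtr_pMl // exprn_gt0.
have : k x x = (lam m)^-1.
  by rewrite /x orthE klam_e coordE eqxx mulr1.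
rewrite klam_quad {1}/x cm1_orthR mulr0 mulr0 mul0r add0r big1 => [/eqP|r _].
  by rewrite eq_sym invr_eq0 (negPf (lam_neq0 m)).
have /eqP := eigc r; rewrite mulf_eq0 (negPf (gt0 r)) => /eqP->.
have /eqP := eigcc r; rewrite mulf_eq0 (negPf (gt0 r)) => /eqP->.
by rewrite expr0n addr0 mulr0.
Qed.

(** The bound holds for [u] and for its inverse, and the two squares multiply to 1. *)
Lemma sgn_sqr u : sgn u ^+ 2 = 1.
Proof.
apply/eqP; rewrite eq_le sgn_sqr_ge1 andbT -[leRHS](expr1n R 2) -(sgnMV u).
by rewrite exprMn ler_peMr ?sqr_ge0 // sgn_sqr_ge1.
Qed.

Lemma sgn_pm1 u : sgn u = 1 \/ sgn u = - 1.
Proof. by have /eqP := sgn_sqr u; rewrite sqrf_eq1 => /orP[] /eqP; tauto. Qed.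

Lemma block_orthR_e0 u i : block i (u e0) = 0.
Proof. by rewrite orthR_e0 linearZ /= [block _ _]hscale_e0 scaler0. Qed.

(** Modulo $e_0$, [u] now commutes with [L] on the hyperplane, hence respects its eigenspaces; these
    are told apart by $\mu_i^2$ because the $\mu_i$ are positive and distinct. *)
Lemma block_orthR_block u i j x : i != j -> block i (u (block j x)) = 0.
Proof.
move=> ij; have := @horiz_orthR_lap u (block j x) erefl.
rewrite sgn_sqr scale1r lap_block !linearZ /= => /(congr1 (block i)).
rewrite linearZ /= block_horiz block_lap => /eqP; rewrite -subr_eq0 -scalerBl.
rewrite scaler_eq0 => /orP[|/eqP//]; rewrite subr_eq0.
have mu_gt0 (l : index) : 0 < mu l.
  have : mu l \in lam_values lam by rewrite mem_nth.
  by rewrite mem_sort mem_undup => /codomP[r ->].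
rewrite eqrXn2 ?(ltW (mu_gt0 _)) // nth_uniq ?sort_uniq ?undup_uniq // => /eqP ji.
by rewrite (val_inj ji) eqxx in ij.
Qed.

Lemma block_orthR u i x :
  block i (u x) = cm1 x *: block i (u em1) + block i (u (block i x)).
Proof.
rewrite [in LHS](osc_decomp x) !linearD !linearZ /= block_orthR_e0 scaler0 addr0.
congr (_ + _); rewrite -(sum_block lam x) !linear_sum (bigD1 i) //= big1 ?addr0 //.
by move=> j ji; rewrite block_orthR_block // eq_sym.
Qed.

(** The $e_0$-coefficient is forced: $-k(a,a)/2$ keeps the image of $e_{-1}$ isotropic, and
    $-k(a,Bx)$ keeps it orthogonal to the images of horizontal vectors. Commutation of [B] with [L]
    yields invariance of the curvature. *)
Lemma orthR_of_motion (s : R) (a : g) (B : {linear g -> g}) :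
    s ^+ 2 = 1 -> horiz a = a ->
    (forall x, horiz (B x) = B x) -> (forall x, B (horiz x) = B x) ->
    (forall x y, k (B x) (B y) = k (horiz x) (horiz y)) ->
    (forall x, B (L x) = L (B x)) ->
  exists u : orthR lam, forall x, u x = s *: (cm1 x *: (em1 + a)
    + (c0 x - cm1 x * (k a a / 2) - k a (B x)) *: e0 + B x).
Proof.
move=> s2 ha hB Bh B_iso BL; pose f x := s *: (cm1 x *: (em1 + a)
  + (c0 x - cm1 x * (k a a / 2) - k a (B x)) *: e0 + B x).
have cm1a : cm1 a = 0 by rewrite -ha.
have c0a : c0 a = 0 by rewrite -ha.
have cm1B x : cm1 (B x) = 0 by rewrite -hB.
have c0B x : c0 (B x) = 0 by rewrite -hB.
have kE x y : k x y = cm1 x * c0 y + c0 x * cm1 y + k (B x) (B y).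
  rewrite B_iso [in LHS](osc_decomp x) [in LHS](osc_decomp y).
  rewrite !(klamDl, klamDr, klamZl, klamZr) !klam_em1l !klam_e0l.
  by rewrite !klam_em1r !klam_e0r !coordE; ring.
have f_lin : linear f.
  move=> l x y; rewrite /f linearP klamDr klamZr.
  by apply: osc_ext => *; rewrite !coordE; ring.
have f_iso x y : k (f x) (f y) = k x y.
  rewrite [RHS]kE /f klamZl klamZr mulrA -expr2 s2 mul1r.
  rewrite !(klamDl, klamDr, klamZl, klamZr) !klam_em1l !klam_e0l.
  rewrite !klam_em1r !klam_e0r !coordE cm1a c0a !cm1B !c0B (klamC _ (B x) a).
  by field.
have [u uE] := isometry_orth f_lin (fun x => klam_nondegenerate lam_neq0)
  (@klamBl _ _ _) f_iso.
have u_curv : u \in preserves_curv (lam := lam).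
  apply/asboolP => x y z; rewrite !uE !curvE //.
  set b := cm1 x *: y - cm1 y *: x.
  have lin2 (h : {linear g -> g}) p q t t' :
      h (p *: t - q *: t') = p *: h t - q *: h t'.
    by rewrite linearB !linearZ.
  have cm1f t : cm1 (f t) = s * cm1 t.
    by rewrite /f !coordE cm1a cm1B; ring.
  have Lf t : L (f t) = s *: (cm1 t *: L a + L (B t)).
    by rewrite /f /lap; apply: osc_ext => *; rewrite !coordE; ring.
  (* The two contributions of [a] cancel by antisymmetry, and the two factors [s] multiply to 1. *)
  have Lfb : L (cm1 (f x) *: f y - cm1 (f y) *: f x) = B (L b).
    rewrite BL !lin2 /= !Lf !cm1f.
    rewrite -[RHS]scale1r -s2.
    by apply: osc_ext => *; rewrite !coordE; ring.
  rewrite Lfb !cm1f.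
  have k_LbBz : k (L b) z = k (B (L b)) (B z) by rewrite kE !coordE; ring.
  (* The extra term in [k a (B (L b))] is the one that the $e_0$-coordinate of [f (L b)] produces on
     the other side. *)
  have -> : k (B (L b)) (f z) = s * (cm1 z * k a (B (L b)) + k (L b) z).
    rewrite klamZr !klamDr !klamZr !klamDr klam_em1r klam_e0r cm1B c0B.
    by rewrite -k_LbBz (klamC _ _ a); ring.
  have Be0 : B e0 = 0 by rewrite -Bh [horiz e0]hscale_e0 linear0.
  have fe0 : f e0 = s *: e0.
    by rewrite /f Be0 klam0r; apply: osc_ext => *; rewrite !coordE; ring.
  have fLb : f (L b) = s *: (B (L b) - k a (B (L b)) *: e0).
    by rewrite /f !coordE; apply: osc_ext => *; rewrite !coordE; ring.
  rewrite -uE linearZ lin2 /= !uE fe0 fLb; congr (_ *: _).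
  by apply: osc_ext => *; rewrite !coordE; ring.
by exists (MkOrthR u_curv).
Qed.

(** * The correspondence between isometries and a sign with motions of the eigenspaces *)

Local Notation target :=
  (Z2 * {dffun forall i : index, motion (kV (i:=i))})%type.
Implicit Types p q : target.

(* The blocks of [u] are normalised by [sgn u], without which the translation
   part of [u * v] would not be that of a product of motions. *)
Definition represents u p : Prop :=
  [/\ sgn u = (p.1 : int)%:~R,
      forall i, block i (u em1) = sgn u *: vsval (translation (p.2 i)) &
      forall i w, block i (u (vsval w)) = sgn u *: vsval (rotation (p.2 i) w)].

Lemma sgnM u v : sgn (u * v)%g = sgn u * sgn v.
Proof. by rewrite /sgn orthRM cm1_orthR. Qed.

Lemma sgn_neq0 u : sgn u != 0.
Proof. by rewrite -sqrf_eq0 sgn_sqr oner_eq0. Qed.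

Lemma cm1_vsval i (w : subvs_of (Vspace i)) : cm1 (vsval w) = 0.
Proof. by rewrite -horiz_vsval. Qed.

Lemma block_orthRZ u i l x : block i (u (l *: x)) = l *: block i (u x).
Proof. by rewrite !linearZ. Qed.

Lemma represents_mul u v p q :
  represents u p -> represents v q -> represents (u * v)%g (p * q)%g.
Proof.
move=> [su tu ru] [sv tv rv]; split=> [|i|i w].
- by rewrite sgnM su sv -intrM.
(* Applying [block_orthR] to [v em1] gives the translation of [u] plus the rotated translation of
   [v], which is the semidirect product law. *)
- rewrite orthRM block_orthR -/(sgn v) tu tv block_orthRZ ru sgnM ffunE /=.
  by rewrite !scalerA (mulrC (sgn v)) -scalerDr.
- rewrite orthRM block_orthR cm1_orthR cm1_vsval mulr0 scale0r add0r rv.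
  by rewrite block_orthRZ ru scalerA mulrC sgnM ffunE /= orthME.
Qed.

Lemma represents_unique u p q : represents u p -> represents u q -> p = q.
Proof.
case: p q => [a m] [b l] [/= sa ta ra] [/= sb tb rb].
have -> : a = b by apply/val_inj/(@intr_inj R); rewrite -sa -sb.
congr (_, _); apply/ffunP => i; apply: motion_ext => [|w].
  by apply/val_inj/(scalerI (sgn_neq0 u)); rewrite /= -ta -tb.
by apply/val_inj/(scalerI (sgn_neq0 u)); rewrite /= -ra -rb.
Qed.

Lemma orthR_horiz u x : (forall i, block i (u x) = block i x) ->
  horiz (u x) = horiz x.
Proof. by move=> ux; rewrite -!(sum_block lam); apply: eq_bigr => i _. Qed.

(** This gives injectivity: the datum fixes [u] modulo $e_0$, and the metric determines the missing
    $e_0$-coordinates. *)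
Lemma represents_eq1 u : represents u 1%g -> u = 1%g.
Proof.
move=> [/= s1 t1 r1]; rewrite mulr1z in s1; rewrite s1 in t1 r1.
have hu_em1 : horiz (u em1) = 0.
  by rewrite -(sum_block lam) big1 // => i _; rewrite t1 ffunE /= linear0.
have u_em1 : u em1 = em1.
  have u1 : u em1 = em1 + c0 (u em1) *: e0.
    by rewrite [LHS]osc_decomp hu_em1 -/(sgn u) s1 scale1r addr0.
  (* The norm of $e_{-1}+te_0$ is $2t$, so isotropy gives $t=0$. *)
  have : k (u em1) (u em1) = 0 by rewrite orthE klam_em1l.
  rewrite {1 2}u1 !(klamDl, klamDr, klamZl, klamZr) !klam_em1l !klam_e0l.
  rewrite !coordE !mulr0 mulr1 add0r addr0 -mulr2n => /eqP.
  by rewrite mulrn_eq0 /= => /eqP c_u; rewrite u1 c_u scale0r addr0.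
have u_e0 : u e0 = e0.
  by rewrite orthR_e0 -[sgn u^-1%g]mul1r -{1}[1]s1 sgnMV scale1r.
have u_horiz x : u (horiz x) = horiz x.
  have hux : horiz (u (horiz x)) = horiz x.
    rewrite -[RHS]horiz_hscale; apply: orthR_horiz => i.
    rewrite block_orthR scale0r add0r block_horiz -(to_blockK i x) r1.
    by rewrite ffunE /= (@orth1E _ _ (kV (i:=i))) scale1r.
  (* The $e_0$-coordinate is the pairing with $e_{-1}$, which [u] fixes. *)
  have c0ux : c0 (u (horiz x)) = 0.
    by rewrite -(klam_em1l lam) -{1}u_em1 orthE klam_em1l.
  rewrite [LHS]osc_decomp hux c0ux cm1_orthR mulr0 !scale0r !add0r //.
do 3!apply/val_inj; apply/lfunP => x; rewrite id_lfunE /=.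
rewrite [in LHS](osc_decomp x) !linearD !linearZ /=.
by rewrite u_em1 u_e0 u_horiz -osc_decomp.
Qed.

Lemma exists_motion u i : exists m : motion (kV (i:=i)),
  block i (u em1) = sgn u *: vsval (translation m) /\
  forall w, block i (u (vsval w)) = sgn u *: vsval (rotation m w).
Proof.
pose f (w : subvs_of (Vspace i)) := sgn u *: to_block i (u (vsval w)).
have f_lin : linear f.
  move=> l x y; rewrite /f /to_block [vsval _]linearP [u _]linearP.
  rewrite [block _ _]linearP [vsproj _ _]linearP /=.
  by rewrite scalerDr !scalerA [_ * l]mulrC.
have f_iso w w' : kV (f w) (f w') = kV w w'.
  have horiz_u (t : subvs_of (Vspace i)) : horiz (u (vsval t)) = block i (u (vsval t)).
    rewrite -(sum_block lam) (bigD1 i) //= big1 ?addr0 // => j ji.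
    by rewrite -(block_vsval t) block_orthR_block.
  rewrite /kV /f !linearZ /= klamZl klamZr mulrA -expr2 sgn_sqr mul1r !to_blockK.
  by rewrite -!horiz_u klam_horiz ?orthE // cm1_orthR cm1_vsval mulr0.
have [r rE] := isometry_orth f_lin (fun w => kV_nondegenerate lam_neq0)
  (fun w w1 w2 => klamBl lam (vsval w) (vsval w1) (vsval w2)) f_iso.
(* Multiplying by [sgn u] also divides by it, since its square is 1. *)
exists (MkMotion (sgn u *: to_block i (u em1)) r); split=> [|w] /=.
  by rewrite linearZ /= to_blockK scalerA -expr2 sgn_sqr scale1r.
by rewrite rE linearZ /= to_blockK scalerA -expr2 sgn_sqr scale1r.
Qed.

Lemma exists_represented u : exists p, represents u p.
Proof.
have [a sa] : exists a : Z2, sgn u = (a : int)%:~R.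
  have [->|->] := sgn_pm1 u; first by exists z2_one.
  by exists (@MkZ2 (-1) isT); rewrite /= mulrN1z.
exists (a, [ffun i => sval (cid (exists_motion u i))]); split=> [//|i|i w] /=.
  by rewrite ffunE; case: cid => m [].
by rewrite ffunE; case: cid => m [].
Qed.

(** Surjectivity: the translations add up to one horizontal vector [a], and the rotations assemble
    into a block-diagonal [B], which commutes with [L] because [L] is scalar on each block. *)
Lemma exists_representing p : exists u, represents u p.
Proof.
case: p => s m; pose S : R := (s : int)%:~R.
have S2 : S ^+ 2 = 1.
  by have := valP s; rewrite /S !inE /= => /orP[] /eqP->; rewrite ?sqrrN expr1n.
pose a : g := \sum_i vsval (translation (m i)).
pose B (x : g) : g := \sum_i vsval (rotation (m i) (to_block i x)).
have B_lin : linear B.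
  move=> l x y; rewrite /B scaler_sumr -big_split /=; apply: eq_bigr => i _.
  by rewrite /to_block !linearP.
pose lB : {linear g -> g} := HB.pack B
  (GRing.isSemilinear.Build R g g _ B (GRing.semilinear_linear B_lin)).
have horiz_sum (w : forall i, subvs_of (Vspace i)) :
    horiz (\sum_i vsval (w i)) = \sum_i vsval (w i).
  by rewrite linear_sum; apply: eq_bigr => i _; exact: horiz_vsval.
have B_horiz x : B (horiz x) = B x.
  by apply: eq_bigr => i _; rewrite /to_block block_horiz.
have B_iso x y : k (B x) (B y) = k (horiz x) (horiz y).
  rewrite -!(sum_block lam) /B klam_sum_vsval.
  under [in RHS]eq_bigr => i _ do rewrite -to_blockK.
  under [X in k _ X]eq_bigr => i _ do rewrite -to_blockK.
  rewrite klam_sum_vsval; apply: eq_bigr => i _.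
  exact: (orthE (rotation (m i))).
have BL x : B (L x) = L (B x).
  rewrite linear_sum; apply: eq_bigr => i _ /=.
  by rewrite lap_vsval /to_block block_lap !linearZ.
have [u uE] := @orthR_of_motion S a lB S2 (horiz_sum _) (fun x => horiz_sum _)
  B_horiz B_iso BL.
have sgn_u : sgn u = S.
  rewrite /sgn uE !coordE -[a]horiz_sum -[lB _]horiz_sum !coordE.
  by ring.
have blockE i (l r : R) x :
    block i (S *: (l *: (em1 + a) + r *: e0 + x)) =
      S *: (l *: block i a + block i x).
  by rewrite /block; apply: osc_ext => *; rewrite !coordE; ring.
exists u; split=> [//|i|i w] /=; rewrite sgn_u uE blockE.
  have -> : lB em1 = 0.
    by transitivity (lB 0); [rewrite /= -B_horiz [horiz em1]hscale_em1
                            | exact: linear0].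
  by rewrite linear0 addr0 scale1r block_sum_vsval.
by rewrite cm1_vsval scale0r add0r block_sum_vsval vsval_to_block.
Qed.

End CurvatureIsometries.

Theorem proposition4p1 (R : realType) (n : nat) (lam : 'I_n -> R)
    (n_gt0 : (0 < n)%N)
    (lam_gt0 : forall i : 'I_n, 0 < lam i)
    (lam_le : forall i j : 'I_n, (i <= j)%N -> lam i <= lam j) :
  exists f : {multiplicative orthR lam ->
      Z2 * {dffun forall i : 'I_(size (lam_values lam)), motion (kV (i:=i))}},
    bijective f.
Proof.
have [f fP] := choice (exists_represented n_gt0 lam_gt0 lam_le).
have [h hP] := choice (exists_representing lam_gt0).
have fM : {morph f : u v / (u * v)%g >-> (u * v)%g}.
  (* Both sides represent the product of [u] and [v]. *)
  move=> u v; apply: represents_unique (fP _) _ => //.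
  exact: represents_mul.
have f1 : f 1%g = 1%g by apply: (mulgI (f 1%g)); rewrite -fM !mulg1.
have f_inj : injective f.
  (* When [f u = f v], the quotient of [u] by [v] is represented by the identity. *)
  move=> u v fuv; apply/divg1_eq/(represents_eq1 n_gt0 lam_gt0 lam_le).
  by rewrite -f1 -(mulgV v) fM -fuv -fM; exact: fP.
have hK p : f (h p) = p.
  exact: (represents_unique n_gt0 lam_gt0 lam_le (fP _) (hP _)).
pose F : {multiplicative orthR lam -> _} :=
  HB.pack f (isMultiplicative.Build _ _ f fM).
by exists F, h => // u; apply: f_inj; rewrite hK.
Qed.
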